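(* Let $(\mathscr{P},\mathcal{A},\mathbb{P})$ be a probability space and let $\mathbf{u}\in L^2(\mathscr{P};\mathbb{R}^{n_0})$. Let $l\ge 2$, let $n_0\ge n_1\ge n_2\ge\dots\ge n_l$ be positive integers, and let $\rho:\mathbb{R}\to\mathbb{R}$ be bilipschitz. For every symmetric orthogonal autoencoder $\boldsymbol{\Psi}=\{(\mathbf{V}_j,\mathbf{b}_j,\rho)\}_{j=1}^{l}\in\mathsf{SOAE}_\rho(n_0,\dots,n_l)$, with encoding layers $e_j$, set $E_0:=\mathsf{Id}_{\mathbb{R}^{n_0}}$ and $E_k:=e_k\circ\dots\circ e_1$ for $k=1,\dots,l$. Then $$\mathbb{E}\|\mathbf{u}-\mathscr{R}(\boldsymbol{\Psi},\mathbf{u})\|^2\ \ge\ \sum_{k=0}^{l-1}\mathrm{Lip}(\rho)^{-2k}\,\mathbb{E}\big\|E_k(\mathbf{u})-\big[\mathbf{V}_{k+1}\mathbf{V}_{k+1}^\top(E_k(\mathbf{u})-\mathbf{b}_{k+1})+\mathbf{b}_{k+1}\big]\big\|^2$$ and $$\mathbb{E}\|\mathbf{u}-\mathscr{R}(\boldsymbol{\Psi},\mathbf{u})\|^2\ \le\ \sum_{k=0}^{l-1}\mathrm{Lip}(\rho^{-1})^{2k}\,\mathbb{E}\big\|E_k(\mathbf{u})-\big[\mathbf{V}_{k+1}\mathbf{V}_{k+1}^\top(E_k(\mathbf{u})-\mathbf{b}_{k+1})+\mathbf{b}_{k+1}\big]\big\|^2.$$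
   Context: $\|\cdot\|$ is the Euclidean norm. $L^2(\mathscr{P};\mathbb{R}^{n})$ is the space of random vectors $\mathbf{u}:\mathscr{P}\to\mathbb{R}^n$ with $\mathbb{E}\|\mathbf{u}\|^2<\infty$. A map $\rho:\mathbb{R}\to\mathbb{R}$ is bilipschitz if there are $\eta,L>0$ with $\eta|x-y|\le|\rho(x)-\rho(y)|\le L|x-y|$ for all $x,y\in\mathbb{R}$; such a map is a bijection of $\mathbb{R}$ with bilipschitz inverse $\rho^{-1}$. $\mathrm{Lip}(f)$ denotes the (smallest) Lipschitz constant of $f$. $\rho$ and $\rho^{-1}$ act componentwise on vectors. Symmetric orthogonal autoencoders: $\mathsf{SOAE}_\rho(n_0,\dots,n_l)$ is the set of all $\boldsymbol{\Psi}=\{(\mathbf{V}_j,\mathbf{b}_j,\rho)\}_{j=1}^{l}$ with $\mathbf{V}_j\in\mathbb{R}^{n_{j-1}\times n_j}$, $\mathbf{V}_j^\top\mathbf{V}_j=\mathbf{I}_{n_j}$, and $\mathbf{b}_j\in\mathbb{R}^{n_{j-1}}$. Its encoding layers are $e_j:\mathbb{R}^{n_{j-1}}\to\mathbb{R}^{n_j}$, $e_j(\mathbf{h})=\rho(\mathbf{V}_j^\top(\mathbf{h}-\mathbf{b}_j))$, and its decoding layers are $d_j:\mathbb{R}^{n_j}\to\mathbb{R}^{n_{j-1}}$, $d_j(\mathbf{h})=\mathbf{V}_j\rho^{-1}(\mathbf{h})+\mathbf{b}_j$. The encoder is $\mathscr{E}(\boldsymbol{\Psi},\cdot)=e_l\circ\dots\circ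 e_1$, the decoder is $\mathscr{D}(\boldsymbol{\Psi},\cdot)=d_1\circ\dots\circ d_l$, and the reconstruction map is $\mathscr{R}(\boldsymbol{\Psi},\cdot)=\mathscr{D}(\boldsymbol{\Psi},\mathscr{E}(\boldsymbol{\Psi},\cdot)):\mathbb{R}^{n_0}\to\mathbb{R}^{n_0}$. *)

(* Defs.v *)
From HB Require Import structures.
From mathcomp Require Import all_boot all_order all_algebra.
From mathcomp Require Import all_classical all_reals all_analysis.
Import Order.TTheory GRing.Theory Num.Theory.
Import numFieldNormedType.Exports.
Set Implicit Arguments.
Unset Strict Implicit.
Unset Printing Implicit Defensive.
Local Open Scope classical_set_scope.
Local Open Scope ring_scope.

(* The norm that the library puts on matrices is the sup norm, so the Euclidean
   one is defined here. *)
Definition enorm (R : realType) (m : nat) (x : 'cV[R]_m) : R :=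
  Num.sqrt (\sum_(i < m) x i ord0 ^+ 2).

(* There is no sigma-algebra on 'cV[R]_m in the library: a random vector is a
   vector whose components are random variables. *)
Definition random_vector d (T : measurableType d) (R : realType) (m : nat)
    (u : T -> 'cV[R]_m) : Prop :=
  forall i : 'I_m, measurable_fun [set: T] (fun w => u w i ord0).

Definition mean_sqnorm d (T : measurableType d) (R : realType)
    (P : probability T R) (m : nat) (u : T -> 'cV[R]_m) : \bar R :=
  'E_P[(fun w => enorm (u w) ^+ 2)%R]%E.

Definition L2_random_vector d (T : measurableType d) (R : realType)
    (P : probability T R) (m : nat) (u : T -> 'cV[R]_m) : Prop :=
  random_vector u /\ (mean_sqnorm P u < +oo)%E.

Definition bilipschitz (R : realType) (f : R -> R) : Prop :=
  exists eta L : R, [/\ 0 < eta, 0 < L &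
    forall x y, eta * `|x - y| <= `|f x - f y| <= L * `|x - y| ].

Definition Lip (R : realType) (f : R -> R) : R :=
  inf [set k : R | 0 <= k /\ k.-lipschitz f].

(* [pinv] is the total inverse of the library; it is a two-sided inverse as soon
   as [f] is a bijection, in particular if [f] is bilipschitz. *)
Definition inverse (R : realType) (f : R -> R) : R -> R := pinv [set: R] f.

(* Layers are numbered from 0: [weight Psi j] and [bias Psi j] are V_{j+1} and
   b_{j+1}. Widths and parameters are families over all of nat, but only
   n 0, ..., n l and the parameters with j < l have a meaning; those with
   l <= j are unconstrained and are not used by the l-layer autoencoder. *)
Record SOAE (R : realType) (rho : R -> R) (l : nat) (n : nat -> nat) := {
  weight : forall j : nat, 'M[R]_(n j, n j.+1);
  bias : forall j : nat, 'cV[R]_(n j);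
  weight_orthogonal :
    forall j : nat, (j < l)%N -> (weight j)^T *m weight j = 1%:M
}.

Section autoencoder.
Context (R : realType) (rho : R -> R) (l : nat) (n : nat -> nat).
Variable Psi : SOAE rho l n.

Definition enc_layer (j : nat) (h : 'cV[R]_(n j)) : 'cV[R]_(n j.+1) :=
  map_mx rho ((weight Psi j)^T *m (h - bias Psi j)).

Definition dec_layer (j : nat) (h : 'cV[R]_(n j.+1)) : 'cV[R]_(n j) :=
  weight Psi j *m map_mx (inverse rho) h + bias Psi j.

(* E_k = e_k o ... o e_1 *)
Fixpoint enc_upto (k : nat) : 'cV[R]_(n 0%N) -> 'cV[R]_(n k) :=
  match k with
  | 0%N => fun x => x
  | j.+1 => fun x => enc_layer (enc_upto j x)
  end.

(* d_1 o ... o d_k *)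
Fixpoint dec_from (k : nat) : 'cV[R]_(n k) -> 'cV[R]_(n 0%N) :=
  match k with
  | 0%N => fun h => h
  | j.+1 => fun h => dec_from (dec_layer h)
  end.

Definition encoder : 'cV[R]_(n 0%N) -> 'cV[R]_(n l) := @enc_upto l.

Definition decoder : 'cV[R]_(n l) -> 'cV[R]_(n 0%N) := @dec_from l.

Definition reconstruction (x : 'cV[R]_(n 0%N)) : 'cV[R]_(n 0%N) :=
  decoder (encoder x).

End autoencoder.

(* Main.v *)
(* Write q_k x for the squared norm of the residual, at E_k x, of the affine
   projection of layer k+1. For every m <= l and every y, not only y = E_m x,
     |x - d_1 (.. (d_m y))|^2 <= \sum_(k < m) c^(2k) q_k x + c^(2m) |E_m x - y|^2
   with c = Lip(rho^-1), and the reverse inequality holds with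
   c = Lip(rho)^-1. The induction on m applies the bound at m to d_{m+1} y:
   by Pythagoras |E_m x - d_{m+1} y|^2 is q_m x plus
   |rho^-1 (E_{m+1} x) - rho^-1 y|^2, since the columns of V_{m+1} are
   orthonormal. Taking m = l and y = E_l x removes the last term, and the
   theorem follows by integration. Since d_{m+1} y need not be in the image of
   the encoder, the lower bound uses that rho is onto. *)
Require Import Defs.
From HB Require Import structures.
From mathcomp Require Import all_boot all_order all_algebra.
From mathcomp Require Import all_classical all_reals all_analysis.
From mathcomp Require Import measurable_realfun.
From mathcomp Require Import ring lra.
Import Order.TTheory GRing.Theory Num.Theory.
Import numFieldNormedType.Exports.
Local Open Scope classical_set_scope.
Local Open Scope ring_scope.
Set Implicit Arguments.
Unset Strict Implicit.
Unset Printing Implicit Defensive.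

(** * Bilipschitz maps of the line: optimal constant, bijectivity, inverse *)

Lemma le_lipschitz_Lip (R : realType) (f : R -> R) (k : R) :
  (forall x y, `|f x - f y| <= k * `|x - y|) ->
  forall x y, `|f x - f y| <= Lip f * `|x - y|.
Proof.
move=> fk x y; have [->|xy] := eqVneq x y; first by rewrite !subrr normr0 mulr0.
have xy_gt0 : 0 < `|x - y| by rewrite normr_gt0 subr_eq0.
(* Each difference quotient is a lower bound of the set of Lipschitz constants, hence at most its
   infimum. *)
rewrite -ler_pdivrMr//; apply: lb_le_inf.
  (* Nonemptiness matters, since [inf] of the empty set is a default value. The witness is [|k|]
     because members must be nonnegative and [k] has no prescribed sign. *)
  exists `|k|; split => // -[a b] _ /=.
  by apply: (le_trans (fk a b)); apply: ler_wpM2r => //; exact: ler_norm.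
move=> c [_ fc]; rewrite ler_pdivrMr//.
by apply: (fc (x, y)).
Qed.

Lemma bilipschitz_continuous (R : realType) (f : R -> R) :
  bilipschitz f -> continuous f.
Proof.
move=> [eta [L [_ L_gt0 fL]]] x; apply/cvgrPdist_le => e e_gt0.
near=> y; have /andP[_ /le_trans] := fL x y; apply.
rewrite mulrC -ler_pdivlMr//; near: y.
by apply: (cvgr_dist_le idfun x) => //; exact: divr_gt0.
Unshelve. all: by end_near. Qed.

Lemma bilipschitz_inj (R : realType) (f : R -> R) :
  bilipschitz f -> injective f.
Proof.
move=> [eta [L [eta_gt0 _ fL]]] x y fxy.
have /andP[+ _] := fL x y.
by rewrite fxy subrr normr0 pmulr_rle0// normr_le0 subr_eq0 => /eqP.
Qed.

(** The lower bound pushes [f x] at least [eta * |x|] away from [f 0], and monotonicity does so in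
    opposite directions at [M] and [- M]. For [M] large enough [v] is enclosed, and the intermediate
    value theorem reaches it. *)
Lemma bilipschitz_surj (R : realType) (f : R -> R) :
  bilipschitz f -> forall v, exists x, f x = v.
Proof.
move=> fbl v; have fc := bilipschitz_continuous fbl.
have finj := bilipschitz_inj fbl.
have [eta [L [eta_gt0 _ fL]]] := fbl.
(* Chosen so that [eta * M] equals [|v - f 0|]. *)
pose M := `|v - f 0| / eta.
have M_ge0 : 0 <= M by rewrite divr_ge0// ltW.
have far (x : R) : `|x| = M -> `|v - f 0| <= `|f x - f 0|.
  move=> xM; have /andP[+ _] := fL x 0.
  by rewrite subr0 xM /M mulrC divfK ?gt_eqF.
have := far M (ger0_norm M_ge0).
have := far (- M) (etrans (normrN _) (ger0_norm M_ge0)).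
have NM : - M <= M by rewrite lerNl (le_trans _ M_ge0)// oppr_le0.
suff H : Num.min (f (- M)) (f M) <= v <= Num.max (f (- M)) (f M) ->
    exists x, f x = v.
  (* A continuous injection of the line is monotone; the two bullets below are the increasing and
     the decreasing case. *)
  have /itv_continuous_inj_mono : {within [set` `]-oo, +oo[%R], continuous f}.
    exact: continuous_subspaceT.
  move=> /(_ (in2W finj)) [/le_mono_in|/le_nmono_in];
    move=> /(fun h x y => h x y isT isT) fmono.
  - rewrite (ler0_norm (x := f (- M) - f 0)); last first.
      by rewrite subr_le0 fmono oppr_le0.
    rewrite (ger0_norm (x := f M - f 0)); last by rewrite subr_ge0 fmono.
    rewrite !ler_norml => /andP[h1 h2] /andP[h3 h4]; apply: H.
    by rewrite ge_min le_max; apply/andP; split; apply/orP;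
      [left|right]; lra.
  - rewrite (ger0_norm (x := f (- M) - f 0)); last first.
      by rewrite subr_ge0 fmono oppr_le0.
    rewrite (ler0_norm (x := f M - f 0)); last by rewrite subr_le0 fmono.
    rewrite !ler_norml => /andP[h1 h2] /andP[h3 h4]; apply: H.
    by rewrite ge_min le_max; apply/andP; split; apply/orP;
      [right|left]; lra.
move=> /(IVT NM (continuous_subspaceT fc))[x _ fx]; by exists x.
Qed.

(** [pinv] is a right inverse on the image of [f] only, so surjectivity enters here; the other
    cancellation, [inverseKV], rests on injectivity. *)
Lemma inverseK (R : realType) (f : R -> R) :
  bilipschitz f -> cancel (inverse f) f.
Proof.
move=> /bilipschitz_surj fsurj y; rewrite /inverse pinvK// inE.
by have [x <-] := fsurj y; exists x.
Qed.

Lemma inverseKV (R : realType) (f : R -> R) :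
  bilipschitz f -> cancel f (inverse f).
Proof.
move=> /bilipschitz_inj finj x; rewrite /inverse pinvKV ?inE//.
exact: in2W.
Qed.

Lemma bilipschitz_Lip (R : realType) (f : R -> R) : bilipschitz f ->
  forall x y, `|f x - f y| <= Lip f * `|x - y|.
Proof.
move=> [eta [L [_ _ fL]]]; apply: (@le_lipschitz_Lip _ _ L) => x y.
by have /andP[] := fL x y.
Qed.

Lemma bilipschitz_Lip_gt0 (R : realType) (f : R -> R) :
  bilipschitz f -> 0 < Lip f.
Proof.
move=> fbl; have := bilipschitz_Lip fbl 1 0.
rewrite subr0 normr1 mulr1; apply: lt_le_trans.
by rewrite normr_gt0 subr_eq0 (inj_eq (bilipschitz_inj fbl)) oner_eq0.
Qed.

Lemma bilipschitz_inverse (R : realType) (f : R -> R) :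
  bilipschitz f -> bilipschitz (inverse f).
Proof.
move=> fbl; have [eta [L [eta_gt0 L_gt0 fL]]] := fbl.
exists L^-1, eta^-1; split; rewrite ?invr_gt0// => x y.
have := fL (inverse f x) (inverse f y); rewrite !inverseK// => /andP[etaf fLxy].
by rewrite mulrC ler_pdivrMr// [_ * L]mulrC fLxy mulrC ler_pdivlMr// mulrC.
Qed.

(** * Euclidean norm and orthogonal projection *)

Section euclidean_norm.
Context {R : realType}.

Lemma sqr_enorm (m : nat) (x : 'cV[R]_m) :
  enorm x ^+ 2 = \sum_(i < m) x i ord0 ^+ 2.
Proof. by rewrite sqr_sqrtr// sumr_ge0// => i _; exact: sqr_ge0. Qed.

Lemma sqr_enorm_mulmx (m : nat) (x : 'cV[R]_m) :
  enorm x ^+ 2 = (x^T *m x) ord0 ord0.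
Proof.
by rewrite sqr_enorm mxE; apply: eq_bigr => i _; rewrite mxE expr2.
Qed.

Lemma le_sqr_enorm (m : nat) (x y : 'cV[R]_m) (c : R) :
  (forall i, `|x i ord0| <= c * `|y i ord0|) ->
  enorm x ^+ 2 <= c ^+ 2 * enorm y ^+ 2.
Proof.
move=> xy; rewrite !sqr_enorm mulr_sumr; apply: ler_sum => i _.
rewrite -real_normK ?num_real// -[y i _ ^+ 2]real_normK ?num_real//.
(* Squaring requires [c * |y i|] to be nonnegative, which holds because it dominates an absolute
   value. *)
by rewrite -exprMn lerXn2r// nnegrE// (le_trans _ (xy i)).
Qed.

(* The residual of the orthogonal projection onto the range of [V] is
   orthogonal to that range, and [V] is an isometry: Pythagoras. *)
Lemma sqr_enorm_affine_residual (m p : nat) (V : 'M[R]_(m, p)) (b h : 'cV[R]_m)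
    (z : 'cV[R]_p) : V^T *m V = 1%:M ->
  enorm (h - (V *m z + b)) ^+ 2 =
  enorm (h - (V *m V^T *m (h - b) + b)) ^+ 2 + enorm (V^T *m (h - b) - z) ^+ 2.
Proof.
move=> VV; set a := h - (V *m V^T *m (h - b) + b).
set c := V^T *m (h - b) - z.
have -> : h - (V *m z + b) = a + V *m c.
  rewrite /a (mulmxBr V _ z) mulmxA; move: (V *m V^T *m _) (V *m z) => p1 p2.
  by apply/matrixP => i j; rewrite !mxE; ring.
have Va : V^T *m a = 0.
  rewrite /a opprD addrA addrAC -mulmxA (mulmxBr V^T (h - b)) (mulmxA V^T V) VV.
  by rewrite mul1mx subrr.
have aV : a^T *m V = 0 by rewrite -[V]trmxK -trmx_mul Va trmx0.
clearbody a c; rewrite !sqr_enorm_mulmx.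
have -> : (a + V *m c)^T = a^T + c^T *m V^T by rewrite linearD /= trmx_mul.
rewrite mulmxDl !mulmxDr.
rewrite (mulmxA a^T) aV mul0mx addr0 -(mulmxA c^T V^T a) Va mulmx0 add0r.
by rewrite -(mulmxA c^T) (mulmxA V^T) VV mul1mx mxE.
Qed.

End euclidean_norm.

(** * Pointwise bounds on the reconstruction error *)

Section reconstruction_error.
Context {R : realType} {rho : R -> R} {l : nat} {n : nat -> nat}.
Variable Psi : SOAE rho l n.
Hypothesis rho_bilip : bilipschitz rho.

Definition projection_error (k : nat) (h : 'cV[R]_(n k)) : 'cV[R]_(n k) :=
  h - (weight Psi k *m (weight Psi k)^T *m (h - bias Psi k) + bias Psi k).

(** Pythagoras with [z] the componentwise inverse image of [y]. The coordinates of [h - b] along the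
    columns of the weight matrix are recovered from the encoding of [h] by undoing [rho]. *)
Lemma sqr_enorm_dec_layer (k : nat) (h : 'cV[R]_(n k)) (y : 'cV[R]_(n k.+1)) :
  (k < l)%N ->
  enorm (h - dec_layer Psi y) ^+ 2 =
  enorm (projection_error h) ^+ 2 +
  enorm (map_mx (inverse rho) (enc_layer Psi h) - map_mx (inverse rho) y) ^+ 2.
Proof.
move=> kl; rewrite sqr_enorm_affine_residual; last exact: weight_orthogonal.
congr (_ + enorm (_ - _) ^+ 2).
rewrite /enc_layer; move: (_ *m _) => v.
by apply/matrixP => i j; rewrite !mxE inverseKV.
Qed.

Lemma sqr_enorm_dec_from_le (c : R) (x : 'cV[R]_(n 0)) :
  (forall a b, `|inverse rho a - inverse rho b| <= c * `|a - b|) ->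
  forall m, (m <= l)%N -> forall y : 'cV[R]_(n m),
  enorm (x - dec_from Psi y) ^+ 2 <=
  \sum_(k < m) c ^+ (2 * k) * enorm (projection_error (enc_upto Psi k x)) ^+ 2 +
  c ^+ (2 * m) * enorm (enc_upto Psi m x - y) ^+ 2.
Proof.
move=> ic; elim=> [_ y|m IH ml y] /=; first by rewrite big_ord0 add0r mul1r.
apply: (le_trans (IH (ltnW ml) _)).
rewrite big_ord_recr /= -[leRHS]addrA lerD2l sqr_enorm_dec_layer//.
(* The residual terms cancel. The extra factor [c ^+ 2] of the next power pays for removing
   [inverse rho] from the remaining difference. *)
rewrite mulrDr lerD2l mulnSr exprD -mulrA ler_wpM2l//.
  by rewrite exprM exprn_ge0// sqr_ge0.
by apply: le_sqr_enorm => i; rewrite !mxE.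
Qed.

Lemma sqr_enorm_dec_from_ge (c : R) (x : 'cV[R]_(n 0)) : 0 < c ->
  (forall a b, `|rho a - rho b| <= c * `|a - b|) ->
  forall m, (m <= l)%N -> forall y : 'cV[R]_(n m),
  \sum_(k < m) c ^- (2 * k) * enorm (projection_error (enc_upto Psi k x)) ^+ 2 +
  c ^- (2 * m) * enorm (enc_upto Psi m x - y) ^+ 2 <=
  enorm (x - dec_from Psi y) ^+ 2.
Proof.
move=> c_gt0 rc; elim=> [_ y|m IH ml y] /=.
  by rewrite big_ord0 add0r expr0 invr1 mul1r.
apply: (le_trans _ (IH (ltnW ml) _)).
rewrite big_ord_recr /= -[leLHS]addrA lerD2l sqr_enorm_dec_layer//.
rewrite mulrDr lerD2l mulnSr exprD invfM -mulrA ler_wpM2l//.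
  by rewrite invr_ge0 exprn_ge0// ltW.
(* With [c ^+ 2] on the right, what remains is the componentwise Lipschitz bound of [rho] between
   inverse images. Writing the entries of [y] as values of [rho] is where surjectivity is used. *)
rewrite mulrC ler_pdivrMr ?exprn_gt0// [leRHS]mulrC.
apply: le_sqr_enorm => i; rewrite [leLHS](_ : _ =
    `|rho (inverse rho (enc_layer Psi (enc_upto Psi m x) i ord0)) -
      rho (inverse rho (y i ord0))|); last by rewrite !inverseK// !mxE.
by apply: (le_trans (rc _ _)); rewrite !mxE.
Qed.

End reconstruction_error.

(** * Measurability of the layers, and expectations of weighted sums *)

Section random_vector.
Context {d : measure_display} {T : measurableType d} {R : realType}.

Lemma random_vectorD {m : nat} (u v : T -> 'cV[R]_m) :
  random_vector u -> random_vector v -> random_vector (fun w => u w + v w).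
Proof.
move=> mu mv i; under eq_fun do rewrite mxE; exact: measurable_funD.
Qed.

Lemma random_vectorN {m : nat} (u : T -> 'cV[R]_m) :
  random_vector u -> random_vector (fun w => - u w).
Proof.
by move=> mu i; under eq_fun do rewrite mxE; exact: measurableT_comp.
Qed.

Lemma random_vector_cst {m : nat} (b : 'cV[R]_m) :
  random_vector (fun _ : T => b).
Proof. by move=> i; exact: measurable_cst. Qed.

Lemma random_vector_mulmx {m p : nat} (A : 'M[R]_(m, p)) (u : T -> 'cV[R]_p) :
  random_vector u -> random_vector (fun w => A *m u w).
Proof.
move=> mu i; under eq_fun do rewrite mxE.
by apply: measurable_sum => j; exact: measurable_funM.
Qed.

Lemma random_vector_map_mx {m : nat} (f : R -> R) (u : T -> 'cV[R]_m) :
  measurable_fun [set: R] f -> random_vector u ->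
  random_vector (fun w => map_mx f (u w)).
Proof.
by move=> mf mu i; under eq_fun do rewrite mxE; exact: measurableT_comp.
Qed.

Lemma measurable_sqr_enorm {m : nat} (u : T -> 'cV[R]_m) :
  random_vector u -> measurable_fun [set: T] (fun w => enorm (u w) ^+ 2).
Proof.
move=> mu; under eq_fun do rewrite sqr_enorm.
by apply: measurable_sum => i; exact: measurable_funX.
Qed.

Context {rho : R -> R} {l : nat} {n : nat -> nat}.
Variable Psi : SOAE rho l n.

Lemma random_vector_enc_upto (u : T -> 'cV[R]_(n 0)) (k : nat) :
  measurable_fun [set: R] rho -> random_vector u ->
  random_vector (fun w => enc_upto Psi k (u w)).
Proof.
move=> mrho mu; elim: k => [//|k IH] /=.
apply: random_vector_map_mx => //; apply: random_vector_mulmx.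
by apply: random_vectorD => //; exact: random_vector_cst.
Qed.

Lemma random_vector_dec_from (k : nat) (u : T -> 'cV[R]_(n k)) :
  measurable_fun [set: R] (inverse rho) -> random_vector u ->
  random_vector (fun w => dec_from Psi (u w)).
Proof.
(* [dec_from] applies its innermost layer first, so the induction hypothesis is used at the decoded
   vector and [u] has to be generalized. *)
move=> mrho; elim: k u => [//|k IH] u mu /=.
apply: IH; apply: random_vectorD; last exact: random_vector_cst.
by apply: random_vector_mulmx; exact: random_vector_map_mx.
Qed.

Lemma random_vector_projection_error (k : nat) (u : T -> 'cV[R]_(n k)) :
  random_vector u -> random_vector (fun w => projection_error Psi (u w)).
Proof.
move=> mu; apply: random_vectorD => //; apply: random_vectorN.
apply: random_vectorD; last exact: random_vector_cst.
by apply: random_vector_mulmx; exact: random_vectorD.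
Qed.

Context (P : probability T R).

(** Gathers the weighted expectations under one integral, so that the pointwise bounds can be
    integrated. Linearity comes from nonnegativity, in the extended reals, where a term may be
    infinite. *)
Lemma sum_mean_sqnorm {m : nat} {p : nat -> nat} {c : nat -> R}
    {v : forall k, T -> 'cV[R]_(p k)} :
  (forall k, 0 <= c k) -> (forall k, random_vector (v k)) ->
  (\sum_(k < m) (c k)%:E * mean_sqnorm P (v k))%E =
  (\int[P]_w (\sum_(k < m) c k * enorm (v k w) ^+ 2)%:E)%E.
Proof.
move=> c_ge0 mv; under [RHS]eq_integral do rewrite -sumEFin.
rewrite ge0_integral_sum//=.
- apply: eq_bigr => k _; rewrite /mean_sqnorm expectation.unlock -ge0_integralZl_EFin//.
  + by move=> w _; rewrite lee_fin sqr_ge0.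
  + by apply/measurable_EFinP; exact: measurable_sqr_enorm.
- move=> k; apply/measurable_EFinP; apply: measurable_funM => //.
  exact: measurable_sqr_enorm.
- by move=> k w _; rewrite lee_fin mulr_ge0// sqr_ge0.
Qed.

End random_vector.

(** * Integration of the pointwise bounds *)

Unset Implicit Arguments.
Set Strict Implicit.
Set Printing Implicit Defensive.

Theorem theorem4p1 (R : realType) (d : measure_display)
    (T : measurableType d) (P : probability T R)
    (l : nat) (n : nat -> nat) (u : T -> 'cV[R]_(n 0%N)) (rho : R -> R)
    (l_ge2 : (2 <= l)%N)
    (n_gt0 : forall k : nat, (k <= l)%N -> (0 < n k)%N)
    (n_noninc : forall k : nat, (k < l)%N -> (n k.+1 <= n k)%N)
    (u_L2 : L2_random_vector P u)
    (rho_bilip : bilipschitz rho)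
    (Psi : SOAE rho l n) :
  (mean_sqnorm P (fun w => u w - reconstruction Psi (u w))%R >=
    \sum_(k < l) (Lip rho ^- (2 * k))%:E *
      mean_sqnorm P (fun w => enc_upto Psi k (u w) -
        (weight Psi k *m (weight Psi k)^T *m
          (enc_upto Psi k (u w) - bias Psi k) + bias Psi k))%R)%E
  /\
  (mean_sqnorm P (fun w => u w - reconstruction Psi (u w))%R <=
    \sum_(k < l) (Lip (inverse rho) ^+ (2 * k))%:E *
      mean_sqnorm P (fun w => enc_upto Psi k (u w) -
        (weight Psi k *m (weight Psi k)^T *m
          (enc_upto Psi k (u w) - bias Psi k) + bias Psi k))%R)%E.
Proof.
have [u_meas _] := u_L2.
have mrho : measurable_fun [set: R] rho.
  by apply: continuous_measurable_fun; exact: bilipschitz_continuous.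
have minv : measurable_fun [set: R] (inverse rho).
  by apply: continuous_measurable_fun; apply: bilipschitz_continuous;
     exact: bilipschitz_inverse.
have mq k : random_vector
    (fun w => projection_error Psi (enc_upto Psi k (u w))).
  apply: random_vector_projection_error; exact: random_vector_enc_upto.
have msum (c : nat -> R) : measurable_fun [set: T] (fun w => \sum_(k < l)
    c k * enorm (projection_error Psi (enc_upto Psi k (u w))) ^+ 2).
  apply: measurable_sum => k; apply: measurable_funM => //.
  exact: measurable_sqr_enorm.
have mrec : measurable_fun [set: T]
    (fun w => enorm (u w - reconstruction Psi (u w)) ^+ 2).
  apply: measurable_sqr_enorm; apply: random_vectorD => //.
  apply: random_vectorN; apply: random_vector_dec_from => //.
  exact: random_vector_enc_upto.
have enorm0 w : enorm (enc_upto Psi l (u w) - encoder Psi (u w)) ^+ 2 = 0.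
  by rewrite subrr sqr_enorm big1// => i _; rewrite mxE expr0n.
split.
(* The residuals of the goal match those in [mq] by unfolding [projection_error]. Both sides then
   are integrals of nonnegative functions, compared pointwise. *)
- rewrite (sum_mean_sqnorm P (c := fun k => Lip rho ^- (2 * k)) _ mq); last first.
    by move=> k; rewrite invr_ge0 exprn_ge0// ltW// bilipschitz_Lip_gt0.
  rewrite /mean_sqnorm expectation.unlock; apply: ge0_le_integral => //.
  + move=> w _; rewrite lee_fin sumr_ge0// => k _.
    by rewrite mulr_ge0 ?sqr_ge0// invr_ge0 exprn_ge0// ltW// bilipschitz_Lip_gt0.
  + exact/measurable_EFinP/(msum (fun k => Lip rho ^- (2 * k))).
  + exact/measurable_EFinP.
  + move=> w _; rewrite lee_fin.
    have := sqr_enorm_dec_from_ge Psi rho_bilip (u w)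
      (bilipschitz_Lip_gt0 rho_bilip) (bilipschitz_Lip rho_bilip) (leqnn l)
      (encoder Psi (u w)).
    by rewrite enorm0 mulr0 addr0.
- rewrite (sum_mean_sqnorm P (c := fun k => Lip (inverse rho) ^+ (2 * k)) _ mq);
    last by move=> k; rewrite exprM exprn_ge0// sqr_ge0.
  rewrite /mean_sqnorm expectation.unlock; apply: ge0_le_integral => //.
  + by move=> w _; rewrite lee_fin sqr_ge0.
  + exact/measurable_EFinP.
  + exact/measurable_EFinP/(msum (fun k => Lip (inverse rho) ^+ (2 * k))).
  + move=> w _; rewrite lee_fin.
    have := sqr_enorm_dec_from_le Psi rho_bilip (u w)
      (bilipschitz_Lip (bilipschitz_inverse rho_bilip)) (leqnn l) (encoder Psi (u w)).
    by rewrite enorm0 mulr0 addr0.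
Qed.
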